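(* Let $n \ge 2$, let $L$ be a finite-dimensional $n$-Lie algebra over a field $F$, let $K$ be an ideal of $L$, and let $S$ be a Cartan subalgebra of $K$. Then $L = K + \mathcal{N}_L(S)$.
   Context: An $n$-Lie algebra over a field $F$ is an $F$-vector space $L$ with a linear map $\Lambda^n L \to L$, $x_1\wedge\dots\wedge x_n \mapsto [x_1,\dots,x_n]$ (so the bracket is $n$-linear and alternating), satisfying the generalised Jacobi identity $$[[x_1,\dots,x_n],y_2,\dots,y_n]=\sum_{i=1}^n [x_1,\dots,[x_i,y_2,\dots,y_n],\dots,x_n].$$ For subspaces $A_1,\dots,A_n$, $[A_1,\dots,A_n]$ denotes the span of all $[a_1,\dots,a_n]$ with $a_i\in A_i$. A subspace $K$ is a subalgebra if $[K,\dots,K]\subseteq K$ and an ideal if $[K,L,\dots,L]\subseteq K$. An $n$-Lie algebra $S$ is nilpotent if $S^r=0$ for some $r$, where $S^1=S$ and $S^{s+1}=[S^s,S,\dots,S]$ (with $n-1$ entries $S$). The normaliser in $L$ of a subalgebra $U$ of $L$ is the subspace $\mathcal{N}_L(U)=\{x\in L\mid [x,u_1,\dots,u_{n-1}]\in U\text{ for all }u_1,\dots,u_{n-1}\in U\}$. A Cartan subalgebra of an $n$-Lie algebra $K$ is a nilpotent subalgebra $S$ of $K$ with $\mathcal{N}_K(S)=S$. *)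

(* Defs.v *)
From HB Require Import structures.
From mathcomp Require Import all_boot all_order all_algebra.
From mathcomp Require Import boolp.

Set Implicit Arguments.
Unset Strict Implicit.
Unset Printing Implicit Defensive.

Import GRing.Theory.

Local Open Scope ring_scope.

Section SetSpan.
Variables (F : fieldType) (L : vectType F).
Implicit Types (X : L -> Prop) (U : {vspace L}) (s : seq L).

Fact setspan_exists X :
  exists s, (forall x, x \in s -> X x) /\ (forall x, X x -> x \in <<s>>%VS).
Proof.
pose p d := `[< exists s, (forall x, x \in s -> X x) /\ \dim <<s>>%VS = d >].
have p0 : exists d, p d.
  by exists 0%N; apply/asboolP; exists [::]; split=> //; rewrite span_nil dimv0.
have pmax d : p d -> (d <= \dim {:L})%N.
  by move=> /asboolP[s [_ <-]]; rewrite dimvS ?subvf.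
case: (ex_maxnP p0 pmax) => d /asboolP[s [sX dims]] dmax.
exists s; split=> // x Xx.
have /dmax : p (\dim <<x :: s>>%VS).
  apply/asboolP; exists (x :: s); split=> // y.
  by rewrite inE => /orP[/eqP->|/sX].
rewrite -dims => le_dim.
have sub : (<<s>> <= <<x :: s>>)%VS by rewrite span_cons addvSr.
have /eqP -> : <<s>>%VS == <<x :: s>>%VS by rewrite eqEdim sub.
by apply: memv_span; rewrite mem_head.
Qed.

(* The linear span of an arbitrary, possibly infinite, subset X of L; the     *)
(* library's <<s>> only takes finite sequences. See setspanP.                 *)
Definition setspan X : {vspace L} := <<projT1 (cid (setspan_exists X))>>%VS.

Lemma mem_setspan X x : X x -> x \in setspan X.
Proof. by rewrite /setspan; case: cid => s [_] /= h /h. Qed.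

Lemma setspan_subP X U :
  (setspan X <= U)%VS <-> (forall x, X x -> x \in U).
Proof.
split=> [/subvP XU x /mem_setspan /XU //|XU].
by rewrite /setspan; case: cid => s [sX _] /=; apply/span_subvP => x /sX /XU.
Qed.

Lemma setspanP X x :
  x \in setspan X <->
  exists s, (forall y, y \in s -> X y) /\ x \in <<s>>%VS.
Proof.
split=> [|[s [sX]]].
  by rewrite /setspan; case: cid => s [sX _] /= xs; exists s.
by apply/subvP/span_subvP => y /sX /mem_setspan.
Qed.

End SetSpan.

Section Arguments.
Variables (n : nat) (T : Type).

Definition setarg (a : {ffun 'I_n -> T}) (i : 'I_n) (x : T) :
    {ffun 'I_n -> T} :=
  [ffun j => if j == i then x else a j].

(* (x, a_2, ..., a_n): the first entry of a is irrelevant. *)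
Definition sethead (x : T) (a : {ffun 'I_n -> T}) : {ffun 'I_n -> T} :=
  [ffun j : 'I_n => if j == 0%N :> nat then x else a j].

End Arguments.

Record nLie_bracket (n : nat) (F : fieldType) (L : vectType F) := NLieBracket {
  nbr :> {ffun 'I_n -> L} -> L;
  nbr_linear : forall (a : {ffun 'I_n -> L}) (i : 'I_n),
    linear (fun x => nbr (setarg a i x));
  nbr_alternating : forall (a : {ffun 'I_n -> L}) (i j : 'I_n),
    i != j -> a i = a j -> nbr a = 0;
  nbr_jacobi : forall x y : {ffun 'I_n -> L},
    nbr (sethead (nbr x) y) =
    \sum_(i < n) nbr (setarg x i (nbr (sethead (x i) y)))
}.

Section NLie.
Variables (n : nat) (F : fieldType) (L : vectType F) (br : nLie_bracket n L).
Implicit Types (K M S U : {vspace L}).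

(* [A_1, ..., A_n] *)
Definition bracketv (A : 'I_n -> {vspace L}) : {vspace L} :=
  setspan (fun x =>
    exists a : {ffun 'I_n -> L}, (forall i, a i \in A i) /\ x = br a).

(* [A, B, ..., B] *)
Definition bracketv_head (A B : {vspace L}) : {vspace L} :=
  bracketv (fun i : 'I_n => if i == 0%N :> nat then A else B).

Definition subalgebra K : Prop := (bracketv (fun=> K) <= K)%VS.

Definition ideal K : Prop := (bracketv_head K fullv <= K)%VS.

(* lcs S r is S^(r+1): the lower central series starts at S^1 = S. *)
Definition lcs S (r : nat) : {vspace L} :=
  iter r (fun A => bracketv_head A S) S.

Definition nilpotent S : Prop := exists r, lcs S r = 0%VS.

Definition normalises U (x : L) : Prop :=
  forall u : {ffun 'I_n -> L}, (forall i, u i \in U) -> br (sethead x u) \in U.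

(* N_M(U) = {x in M | [x, u_1, ..., u_(n-1)] in U for all u_i in U}. This set *)
(* is already a subspace (mem_normaliser); setspan only gives it the type of  *)
(* subspaces.                                                                 *)
Definition normaliser M U : {vspace L} :=
  setspan (fun x => x \in M /\ normalises U x).

Definition cartan_subalgebra K S : Prop :=
  [/\ (S <= K)%VS, subalgebra S, nilpotent S & normaliser K S = S].

Lemma normalises_linear U c x y : (0 < n)%N ->
  normalises U x -> normalises U y -> normalises U (c *: x + y).
Proof.
move=> n0 Ux Uy u uU; have headE z : sethead z u = setarg u (Ordinal n0) z.
  by apply/ffunP => j; rewrite !ffunE.
rewrite headE nbr_linear -!headE.
by rewrite memvD ?memvZ ?Ux ?Uy.
Qed.

Lemma mem_normaliser M U x : (0 < n)%N ->
  x \in normaliser M U <-> x \in M /\ normalises U x.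
Proof.
move=> n0; split=> [|xP]; last exact: mem_setspan.
move=> /setspanP[s [+ xs]]; move: x xs.
elim: s => [|y s IH] x.
  rewrite span_nil memv0 => /eqP-> _; split; first exact: mem0v.
  move=> u uU; have -> : sethead 0 u = setarg u (Ordinal n0) 0.
    by apply/ffunP => j; rewrite !ffunE.
  have := nbr_linear br u (Ordinal n0) (- 1) 0 0.
  by rewrite scaler0 addr0 scaleN1r addNr => ->; rewrite mem0v.
rewrite span_cons => /memv_addP[_ /vlineP[c ->] [z zs ->]] sP.
have [yM yU] := sP y (mem_head _ _).
have [|zM zU] := IH z zs; first by move=> w ws; apply: sP; rewrite inE ws orbT.
by split; [rewrite memvD ?memvZ | exact: normalises_linear].
Qed.

End NLie.

(* Main.v *)
Require Import Defs.
From HB Require Import structures.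
From mathcomp Require Import all_boot all_order all_algebra.
From mathcomp Require Import boolp.

(** The operators [x |-> [x, s_2, ..., s_n]] with [s_i] in [S] generate a
    nilpotent Lie algebra acting on [L], by the lower central series of [S], and
    they map [L] into [K].  Induct on the dimension of a subspace [M] containing
    [S] and stable under them.  If one of them is not nilpotent on [M], its
    Fitting decomposition splits [M] into a smaller stable subspace containing
    [S] and a subspace of [K].  If all are nilpotent on [M], then an Engel
    argument on [(K :&: M) / S] and the self-normalising property force
    [K :&: M <= S], so that [M] normalises [S]. *)

Set Implicit Arguments.
Unset Strict Implicit.
Unset Printing Implicit Defensive.

Import GRing.Theory.

Local Open Scope ring_scope.

(** * Stabilising kernels and the Fitting decomposition *)

Section LinearAlgebra.
Variables (F : fieldType) (L : vectType F).
Implicit Types (f : 'End(L)) (M U W : {vspace L}).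

Lemma exists_minv (P : {vspace L} -> Prop) U :
  P U -> exists2 W, P W & forall W', P W' -> (W' <= W)%VS -> W' = W.
Proof.
move: {2}(\dim U) (leqnn (\dim U)) => d.
elim: d U => [|d IHd] U leUd PU.
  exists U => // W' _ sWU; apply/eqP; rewrite eqEdim sWU /=.
  exact: leq_trans leUd _.
have [[W [PW sWU ltWU]]|minU] :=
  pselect (exists W, [/\ P W, (W <= U)%VS & (\dim W < \dim U)%N]).
  by apply: (IHd W) => //; rewrite -ltnS (leq_trans ltWU).
exists U => // W' PW' sW'U; apply/eqP; rewrite eqEdim sW'U /= leqNgt.
by apply/negP => ltW'U; apply: minU; exists W'.
Qed.

Definition lfun_iter f d : 'End(L) := iter d (comp_lfun f) \1%VF.

Lemma lfun_iterE f d x : lfun_iter f d x = iter d f x.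
Proof. by elim: d => [|d IHd] /=; rewrite ?id_lfunE // comp_lfunE IHd. Qed.

Lemma iter_lfun0 f d : iter d f 0 = 0.
Proof. by elim: d => //= d ->; rewrite linear0. Qed.

Lemma iter_lfun_le f m d x : (m <= d)%N -> iter m f x = 0 -> iter d f x = 0.
Proof. by move=> /subnK <-; rewrite iterD => ->; rewrite iter_lfun0. Qed.

(** Kernels of powers of [f] increase and have bounded dimension, so one of maximal dimension
    contains all the others. Positivity of [d] later puts the image of the [d]-th power inside that
    of [f]. *)
Lemma iter_lfun_stab f :
  exists2 d, (0 < d)%N & forall m x, iter m f x = 0 -> iter d f x = 0.
Proof.
pose q e := `[< exists d, \dim (lker (lfun_iter f d)) = e >].
have q0 : exists e, q e.
  by exists (\dim (lker (lfun_iter f 0))); apply/asboolP; exists 0%N.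
have qmax e : q e -> (e <= \dim {:L})%N.
  by move=> /asboolP[d <-]; rewrite dimvS ?subvf.
case: (ex_maxnP q0 qmax) => e /asboolP[d dimd] emax.
exists d.+1 => // m x fmx; apply: (@iter_lfun_le _ d) => //.
have sub : (lker (lfun_iter f d) <= lker (lfun_iter f (maxn m d)))%VS.
  apply/subvP => y; rewrite !memv_ker !lfun_iterE => /eqP fy.
  by rewrite (iter_lfun_le _ fy) ?leq_maxr.
have /eqP eq_ker : lker (lfun_iter f d) == lker (lfun_iter f (maxn m d)).
  by rewrite eqEdim sub dimd emax //; apply/asboolP; exists (maxn m d).
apply/eqP; rewrite -lfun_iterE -memv_ker eq_ker memv_ker lfun_iterE.
by rewrite (iter_lfun_le _ fmx) ?leq_maxl.
Qed.

Lemma iter_lfun_stable f M d x :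
  (forall y, y \in M -> f y \in M) -> x \in M -> iter d f x \in M.
Proof. by move=> fM xM; elim: d => //= d /fM. Qed.

(** By [stab], an image vector killed by the [d]-th power is zero, so the two summands are
    independent; rank-nullity then gives equal dimensions. *)
Lemma fitting f M d :
    (forall m x, iter m f x = 0 -> iter d f x = 0) ->
    (forall x, x \in M -> f x \in M) ->
  M = (M :&: lker (lfun_iter f d) + lfun_iter f d @: M)%VS.
Proof.
move=> stab fM; apply/eqP; rewrite eq_sym eqEdim; apply/andP; split.
  rewrite subv_add capvSl; apply/subvP => _ /memv_imgP[y yM ->].
  by rewrite lfun_iterE iter_lfun_stable.
rewrite dimv_disjoint_sum ?limg_ker_dim //.
apply/eqP; rewrite -subv0; apply/subvP => x.
rewrite !memv_cap memv_ker lfun_iterE.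
move=> /andP[/andP[_ /eqP fx0] /memv_imgP[y _ xy]].
by move: fx0; rewrite xy lfun_iterE -iterD => /stab ->; apply: mem0v.
Qed.

(* This is nilpotency of [f] on the quotient by [U]. *)
Lemma last_iter_notin f U m x :
  iter m f x = 0 -> x \notin U ->
  exists2 i, iter i f x \notin U & f (iter i f x) \in U.
Proof.
elim: m x => [|m IHm] x /=; first by move=> ->; rewrite mem0v.
rewrite -iterS iterSr => fx0 xU.
case: (boolP (f x \in U)) => [fxU|fxU]; first by exists 0%N.
have [i] := IHm _ fx0 fxU; rewrite -!iterSr => h1 h2.
by exists i.+1; rewrite // iterS iterSr.
Qed.

End LinearAlgebra.

(** * The operators [ad s], their commutators and weights *)

Section Adjoint.
Variables (n : nat) (F : fieldType) (L : vectType F) (br : nLie_bracket n.+1 L).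
Implicit Types (K M S U W : {vspace L}) (s t : {ffun 'I_n.+1 -> L}).

Lemma sethead_ord0 s x : sethead x s = setarg s ord0 x.
Proof. by apply/ffunP => j; rewrite !ffunE. Qed.

Definition ad_fun s x := br (setarg s ord0 x).

HB.instance Definition _ s :=
  GRing.isLinear.Build F L L *:%R (ad_fun s) (nbr_linear br s ord0).

(** Slot [ord0] of [s] is overwritten by the argument, so [s] is constrained below only at indices
    [i != ord0]. *)
Definition ad s : 'End(L) := linfun (ad_fun s).

Lemma adE s x : ad s x = br (setarg s ord0 x).
Proof. by rewrite lfunE. Qed.

Lemma br_setarg0 s i : br (setarg s i 0) = 0.
Proof.
have := nbr_linear br s i (- 1) 0 0.
by rewrite scaler0 addr0 scaleN1r addNr.
Qed.

Lemma br_eq0 s i : s i = 0 -> br s = 0.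
Proof.
move=> si0; rewrite -(br_setarg0 s i); congr (br _); apply/ffunP => j.
by rewrite ffunE; case: eqP => // ->.
Qed.

Lemma br_setargD s i x y :
  br (setarg s i (x + y)) = br (setarg s i x) + br (setarg s i y).
Proof. by have := nbr_linear br s i 1 x y; rewrite !scale1r. Qed.

Lemma setargC s i j x y : i != j ->
  setarg (setarg s i x) j y = setarg (setarg s j y) i x.
Proof.
move=> neq_ij; apply/ffunP => k; rewrite !ffunE.
by case: (eqVneq k j) => // ->; rewrite eq_sym (negPf neq_ij).
Qed.

(** Polarisation of the vanishing diagonal at [x + y]. *)
Lemma br_swap s i j x y : i != j ->
  br (setarg (setarg s i x) j y) = - br (setarg (setarg s i y) j x).
Proof.
move=> neq_ij; apply/eqP; rewrite -addr_eq0; apply/eqP.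
have diag z : br (setarg (setarg s i z) j z) = 0.
  apply: (nbr_alternating br neq_ij); rewrite !ffunE !eqxx.
  by rewrite (negPf neq_ij).
have := diag (x + y).
rewrite br_setargD !(setargC _ _ _ neq_ij) !br_setargD -!(setargC _ _ _ neq_ij).
by rewrite !diag add0r addr0 addrC.
Qed.

(** The Jacobi identity with its first summand isolated: the commutator of [ad t] and [ad s] is a
    sum of operators of the same kind, with one entry of [s] bracketed by [t]. *)
Lemma ad_comm s t x :
  ad t (ad s x) = ad s (ad t x) +
    \sum_(i | i != ord0) ad (setarg s i (br (sethead (s i) t))) x.
Proof.
rewrite !adE -!sethead_ord0 nbr_jacobi (bigD1 ord0) //=; congr (_ + _).
  rewrite !sethead_ord0; congr (br _); apply/ffunP => j; rewrite !ffunE /=.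
  by case: eqP => // _; rewrite eqxx.
apply: eq_bigr => i i0; rewrite adE !sethead_ord0 setargC 1?eq_sym //.
by rewrite ffunE (negPf i0).
Qed.

Lemma bracketv_headP A B U :
  (bracketv_head br A B <= U)%VS <->
  forall x s, x \in A -> (forall i, i != ord0 -> s i \in B) -> ad s x \in U.
Proof.
split=> [/setspan_subP sub x s xA sB|sub].
  apply: sub; exists (setarg s ord0 x); rewrite adE; split=> // i.
  rewrite ffunE; case: (eqVneq i ord0) => [->|i0] //=.
  by rewrite -[0%N]/(val (@ord0 n)) val_eqE (negPf i0) sB.
apply/setspan_subP => _ [a [aP ->]].
have -> : a = setarg a ord0 (a ord0).
  by apply/ffunP => i; rewrite ffunE; case: eqP => // ->.
rewrite -adE; apply: sub; first exact: (aP ord0).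
move=> i i0; have := aP i.
by rewrite -[0%N]/(val (@ord0 n)) val_eqE (negPf i0).
Qed.

Lemma ad_lcs S r x s : x \in lcs br S r -> (forall i, i != ord0 -> s i \in S) ->
  ad s x \in lcs br S r.+1.
Proof. exact: (bracketv_headP (lcs br S r) S _).1 (subvv _) x s. Qed.

Lemma subalgebra_ad S x s : subalgebra br S -> x \in S ->
  (forall i, i != ord0 -> s i \in S) -> ad s x \in S.
Proof.
move=> /setspan_subP subS xS sS; apply: subS; exists (setarg s ord0 x).
by rewrite adE; split=> // i; rewrite ffunE; case: eqVneq => // /sS.
Qed.

Lemma lcs_sub S r : subalgebra br S -> (lcs br S r <= S)%VS.
Proof.
move=> subS; elim: r => [|r IHr] //; apply/bracketv_headP => x s xS sS.
by apply: subalgebra_ad => //; apply: subvP IHr _ xS.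
Qed.

Lemma lcs_eq0 S r m : lcs br S r = 0%VS -> (r <= m)%N -> lcs br S m = 0%VS.
Proof.
move=> Sr0 /subnK <-; elim: (m - r)%N => //= k IHk.
apply/eqP; rewrite -subv0; apply/bracketv_headP => x s.
by rewrite -/(lcs br S _) IHk memv0 => /eqP-> _; rewrite linear0 mem0v.
Qed.

Lemma iter_ad_lcs S s d x : (forall i, i != ord0 -> s i \in S) -> x \in S ->
  iter d (ad s) x \in lcs br S d.
Proof. by move=> sS xS; elim: d => //= d IHd; apply: ad_lcs. Qed.

(** [ideal] speaks of the first slot; alternation swaps [s i] into it at the cost of a sign. *)
Lemma ideal_ad K x s i : ideal br K -> i != ord0 -> s i \in K -> ad s x \in K.
Proof.
move=> idK i0 siK; rewrite adE.
have -> : setarg s ord0 x = setarg (setarg s ord0 x) i (s i).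
  apply/ffunP => j; rewrite !ffunE; case: (eqVneq j i) => // ->.
  by rewrite (negPf i0).
rewrite br_swap 1?eq_sym // setargC 1?eq_sym // -adE memvN.
by apply: ((bracketv_headP _ _ _).1 idK) => // j _; apply: memvf.
Qed.

Definition weight_ge S k s :=
  exists2 w : 'I_n.+1 -> nat, forall i, i != ord0 -> s i \in lcs br S (w i) &
    (k <= \sum_(i | i != ord0) w i)%N.

Lemma weight_ge0 S s : (forall i, i != ord0 -> s i \in S) -> weight_ge S 0 s.
Proof. by exists (fun=> 0%N). Qed.

Lemma weight_geW S k s : subalgebra br S -> weight_ge S k s ->
  forall i, i != ord0 -> s i \in S.
Proof. by move=> subS [w ws _] i /ws; apply: subvP; apply: lcs_sub. Qed.

(** Bracketing with [S] pushes entry [i] one term deeper, so every correction term in [ad_comm]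
    gains weight. *)
Lemma weight_ge_bracket S k s t i : (forall i, i != ord0 -> t i \in S) ->
  i != ord0 -> weight_ge S k s ->
  weight_ge S k.+1 (setarg s i (br (sethead (s i) t))).
Proof.
move=> tS i0 [w ws kw]; exists (fun j => (j == i) + w j)%N => [j j0|].
  rewrite ffunE; case: eqVneq => [->|_]; last exact: ws.
  by rewrite sethead_ord0 -adE ad_lcs ?ws.
rewrite big_split /= (bigD1 i) //= eqxx -addnA add1n ltnS.
by rewrite (leq_trans kw) ?leq_addl.
Qed.

(** Pigeonhole: if the depths of [n] entries sum to more than [n * r], one is at least [r], and that
    entry is zero. *)
Lemma weight_ge_ad0 S r k s x : lcs br S r = 0%VS -> (n * r < k)%N ->
  weight_ge S k s -> ad s x = 0.
Proof.
move=> Sr0 ltk [w ws kw].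
have [[i i0 rwi]|small] :=
  pselect (exists2 i : 'I_n.+1, i != ord0 & (r <= w i)%N).
  rewrite adE; apply: (@br_eq0 _ i); rewrite ffunE (negPf i0).
  by apply/eqP; rewrite -memv0 -(lcs_eq0 Sr0 rwi) ws.
suff : (\sum_(i < n.+1 | i != ord0) w i <= n * r)%N.
  by move=> /(leq_trans kw) /(leq_trans ltk); rewrite ltnn.
have -> : (n * r = \sum_(i < n.+1 | i != ord0) r)%N.
  by rewrite sum_nat_const cardC1 card_ord.
apply: leq_sum => i i0; rewrite leqNgt; apply/negP => /ltnW rwi.
by apply: small; exists i.
Qed.

(* [weight_ge] plays the role of the lower central series of the Lie algebra *)
(* generated by the operators [ad s]: the induction is downward on the weight.*)
Lemma ad_ind S (P : {ffun 'I_n.+1 -> L} -> Prop) :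
    subalgebra br S -> nilpotent br S ->
    (forall s, (forall x, ad s x = 0) -> P s) ->
    (forall s, (forall i, i != ord0 -> s i \in S) ->
      (forall t i, (forall j, j != ord0 -> t j \in S) -> i != ord0 ->
        P (setarg s i (br (sethead (s i) t)))) -> P s) ->
  forall s, (forall i, i != ord0 -> s i \in S) -> P s.
Proof.
move=> subS [r Sr0] P0 PS s /weight_ge0.
have : ((n * r).+1 <= 0 + (n * r).+1)%N by [].
move: 0%N {2}(n * r).+1 => k j; elim: j k s => [|j IHj] k s lek sk.
  apply: P0 => x; apply: (weight_ge_ad0 _ Sr0 _ sk).
  by rewrite addn0 in lek.
apply: PS (weight_geW subS sk) _ => t i tS i0; apply: (IHj k.+1).
  by rewrite addSnnS.
exact: weight_ge_bracket.
Qed.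

End Adjoint.

(** * Null components, Engel's argument and the induction on [M] *)

Section Cartan.
Variables (n : nat) (F : fieldType) (L : vectType F) (br : nLie_bracket n.+1 L).
Implicit Types (K M S U W : {vspace L}) (s t : {ffun 'I_n.+1 -> L}).

Definition ad_stable S M :=
  forall s, (forall i, i != ord0 -> s i \in S) ->
  forall x, x \in M -> ad br s x \in M.

Lemma ad_stable_cap S M U : ad_stable S M -> ad_stable S U ->
  ad_stable S (M :&: U).
Proof.
by move=> stM stU s sS x; rewrite !memv_cap => /andP[/stM-> // /stU->].
Qed.

(** Membership in the Fitting null component of [ad t]. *)
Definition ad_null t x := exists m, iter m (ad br t) x = 0.

Lemma ad_nullD t x y : ad_null t x -> ad_null t y -> ad_null t (x + y).
Proof.
move=> [m mx] [d dy]; exists (maxn m d); rewrite -lfun_iterE linearD /=.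
rewrite !lfun_iterE (iter_lfun_le _ mx) ?leq_maxl //.
by rewrite (iter_lfun_le _ dy) ?leq_maxr // addr0.
Qed.

(** Outer induction on [s] by [ad_ind], inner induction on the exponent killing [x]: by [ad_comm],
    [ad t (ad s x)] is [ad s (ad t x)], where the exponent drops, plus terms covered by the outer
    hypothesis. *)
Lemma ad_null_stable S t s x : subalgebra br S -> nilpotent br S ->
    (forall i, i != ord0 -> t i \in S) -> (forall i, i != ord0 -> s i \in S) ->
  ad_null t x -> ad_null t (ad br s x).
Proof.
move=> subS nilS tS sS; move: s sS x.
apply: (ad_ind subS nilS) => [s s0 x _|s sS IHs x [m]].
  by exists 0%N; rewrite s0.
elim: m x => [|m IHm] x; first by move=> /= ->; exists 0%N; rewrite /= linear0.
move=> null_x; have [d d0] : ad_null t (ad br t (ad br s x)).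
  rewrite ad_comm; apply: ad_nullD; first by apply: IHm; rewrite -iterSr.
  apply: (big_ind (ad_null t)) => [||i i0]; first by exists 0%N.
    exact: ad_nullD.
  by apply: IHs => //; exists m.+1.
by exists d.+1; rewrite iterSr.
Qed.

(** A minimal stable subspace [W] of [M] not inside [S] is mapped into [S] by every [ad s], so any
    vector of [W] outside [S] will do. *)
Lemma engel S M : subalgebra br S -> nilpotent br S -> ad_stable S M ->
    (forall t x, (forall i, i != ord0 -> t i \in S) -> x \in M ->
      ad_null t x) ->
    ~~ (M <= S)%VS ->
  exists x, [/\ x \in M, x \notin S &
    forall s, (forall i, i != ord0 -> s i \in S) -> ad br s x \in S].
Proof.
move=> subS nilS stM nullM MS.
pose P W := [/\ (W <= M)%VS, ad_stable S W & ~~ (W <= S)%VS].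
have [W [WM stW WS] minW] : exists2 W, P W &
    forall W', P W' -> (W' <= W)%VS -> W' = W.
  by apply: (@exists_minv _ _ _ M); split.
have {}minW s : (forall i, i != ord0 -> s i \in S) ->
    forall x, x \in W -> ad br s x \in S.
  move: s; apply: (ad_ind subS nilS) => [s s0 x _|s sS IHs x xW].
    by rewrite s0 mem0v.
  suff eqW : (W :&: (ad br s @^-1: S))%VS = W.
    by move: xW; rewrite -{1}eqW memv_cap -memv_preim => /andP[].
  apply: minW; last exact: capvSl.
  split; first by apply: subv_trans WM; apply: capvSl.
    move=> t tS y; rewrite !memv_cap -!memv_preim => /andP[yW yS].
    (* [ad s (ad t y)] is [ad t (ad s y)] minus the correction terms, which lie in [S] by
       induction. *)
    rewrite stW //= -[ad br s _](addrK (\sum_(i | i != ord0)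
      ad br (setarg s i (br (sethead (s i) t))) y)).
    rewrite -ad_comm memvB //; first exact: subalgebra_ad.
    by apply: memv_suml => i i0; apply: IHs.
  (* The last iterate of [y] under [ad s] outside [S] lies in the intersection. *)
  have /subvPn[y yW yS] := WS.
  have [m m0] := nullM s y sS (subvP WM _ yW).
  have [i iS fiS] := last_iter_notin m0 yS.
  apply/subvPn; exists (iter i (ad br s) y) => //.
  by rewrite memv_cap -memv_preim fiS iter_lfun_stable //; apply: stW.
have /subvPn[x xW xS] := WS.
by exists x; split=> // [|s sS]; [apply: subvP WM _ xW | apply: minW].
Qed.

Lemma cartan_complement K S M : (0 < n)%N -> ideal br K ->
    cartan_subalgebra br K S -> (S <= M)%VS -> ad_stable S M ->
  (M <= K + normaliser br fullv S)%VS.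
Proof.
move=> n_gt0 idK [SK subS nilS normS].
have adK s x : (forall i, i != ord0 -> s i \in S) -> ad br s x \in K.
  (* The second slot exists and holds an element of [S], hence of [K]. *)
  move=> sS; pose i : 'I_n.+1 := lift ord0 (Ordinal n_gt0).
  have i0 : i != ord0 by [].
  exact: ideal_ad idK i0 (subvP SK _ (sS i i0)).
move: {2}(\dim M) (leqnn (\dim M)) => d; elim: d M => [|d IHd] M leMd SM stM.
  by move: leMd; rewrite leqn0 dimv_eq0 => /eqP->; apply: sub0v.
have [[t tS [x xM tx]]|nullM] := pselect (exists2 t : {ffun 'I_n.+1 -> L},
    forall i, i != ord0 -> t i \in S & exists2 x, x \in M & ~ ad_null t x).
  have [e e_gt0 stab] := iter_lfun_stab (ad br t).
  (* The image summand lies in [K]; the null summand is smaller because it misses [x], and contains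
     [S] because [S] is nilpotent. *)
  rewrite (fitting stab (stM t tS)) subv_add; apply/andP; split; last first.
    apply: subv_trans (addvSl _ _); apply/subvP => _ /memv_imgP[y _ ->].
    by rewrite lfun_iterE; case: e e_gt0 {stab} => //= e _; apply: adK.
  have kerP y : (y \in lker (lfun_iter (ad br t) e)) <-> ad_null t y.
    rewrite memv_ker lfun_iterE; split=> [/eqP|[m /stab->]] //.
    by exists e.
  apply: IHd.
  - rewrite -ltnS (leq_trans _ leMd) // ltnNge; apply/negP => le_dim.
    have /eqP eqM : (M :&: lker (lfun_iter (ad br t) e))%VS == M.
      by rewrite eqEdim capvSl.
    by apply/tx/kerP; move: xM; rewrite -eqM memv_cap => /andP[].
  - rewrite subv_cap SM; apply/subvP => y yS; apply/kerP.
    have [r r0] := nilS; exists r; apply/eqP.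
    by rewrite -memv0 -r0 iter_ad_lcs.
  - apply: ad_stable_cap => // s sS y /kerP ty; apply/kerP.
    exact: ad_null_stable tS sS ty.
have {}nullM t y : (forall i, i != ord0 -> t i \in S) -> y \in M -> ad_null t y.
  move=> tS yM; apply: contrapT => ty.
  by apply: nullM; exists t => //; exists y.
have KMS : (K :&: M <= S)%VS.
  apply/negPn/negP => KM.
  have [||x [xKM /negP xS adxS]] := engel subS nilS _ _ KM.
  - by apply: ad_stable_cap => // s sS x _; apply: adK.
  - by move=> t x tS; rewrite memv_cap => /andP[_ /nullM]; apply.
  (* The vector from [engel] normalises [S] inside [K], so it belongs to [S], a contradiction. *)
  apply: xS; rewrite -normS; apply/mem_normaliser => //; split.
    by move: xKM; rewrite memv_cap => /andP[].
  by move=> u uS; rewrite sethead_ord0 -adE adxS.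
apply: subv_trans (addvSr _ _); apply/subvP => x xM.
apply/mem_normaliser => //; split; first exact: memvf.
move=> u uS; rewrite sethead_ord0 -adE; apply: subvP KMS _ _.
by rewrite memv_cap adK ?stM.
Qed.

End Cartan.

Theorem theorem4p5 (n : nat) (n_ge2 : (2 <= n)%N) (F : fieldType)
    (L : vectType F) (br : nLie_bracket n L) (K S : {vspace L}) :
  ideal br K -> cartan_subalgebra br K S ->
  fullv = (K + normaliser br fullv S)%VS.
Proof.
case: n n_ge2 br => // n n_gt0 br idK cartanS.
apply/eqP; rewrite eq_sym eqEsubv subvf.
apply: (cartan_complement n_gt0 idK cartanS (subvf S)) => s _ x _.
exact: memvf.
Qed.
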